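(* Let $p$ be any prime and let $a$ be a positive integer. Then $$p^{a-1}\sum_{k=1}^{p^a-1}\frac{\binom{2k}{k}}{k}\equiv\begin{cases}2\pmod{p^3}&\text{if } p=2,\\ 5\pmod{p^3}&\text{if } p=3,\\ \frac{8}{9}\,p^2B_{p-3}\pmod{p^3}&\text{otherwise.}\end{cases}$$
   Context: $B_0,B_1,B_2,\ldots$ are the Bernoulli numbers, defined by $\frac{t}{e^t-1}=\sum_{n\ge0}B_n\frac{t^n}{n!}$. Congruences modulo $p^3$ between rational numbers are understood in the ring of rational numbers whose denominator is prime to $p$. *)

(* Defs.v *)
From HB Require Import structures.
From mathcomp Require Import all_boot all_order all_algebra.

Set Implicit Arguments.
Unset Strict Implicit.
Unset Printing Implicit Defensive.
Import Order.TTheory GRing.Theory Num.Theory.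
Local Open Scope ring_scope.

(* A formal power series over the rationals is its sequence of coefficients. *)
Definition fps := nat -> rat.

Definition fps_mul (f g : fps) : fps :=
  fun n => \sum_(i < n.+1) f (n - i)%N * g i.

Definition fps_one : fps := fun n => (n == 0%N)%:R.
Definition fps_X : fps := fun n => (n == 1%N)%:R.
Definition fps_exp : fps := fun n => (n`!%:R)^-1.

(* The first n coefficients of 1 / f, where f 0 != 0. *)
Fixpoint fps_inv_seq (f : fps) (n : nat) : seq rat :=
  if n is m.+1 then
    let s := fps_inv_seq f m in
    rcons s ((fps_one m - \sum_(i < m) f (m - i)%N * s`_i) / f 0%N)
  else [::].

Definition fps_inv (f : fps) : fps := fun n => (fps_inv_seq f n.+1)`_n.

Lemma size_fps_inv_seq f n : size (fps_inv_seq f n) = n.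
Proof. by elim: n => //= n IHn; rewrite size_rcons IHn. Qed.

Lemma nth_fps_inv_seq f n i : (i < n)%N -> (fps_inv_seq f n)`_i = fps_inv f i.
Proof.
elim: n => // n IHn; rewrite ltnS leq_eqVlt => /predU1P[-> // | lt_in].
by rewrite /= nth_rcons size_fps_inv_seq lt_in IHn.
Qed.

Lemma fps_mulV f : f 0%N != 0 -> fps_mul f (fps_inv f) =1 fps_one.
Proof.
move=> f0 n; rewrite /fps_mul big_ord_recr /= subnn.
rewrite [fps_inv f n]/fps_inv /= nth_rcons size_fps_inv_seq ltnn eqxx.
under [X in _ - X]eq_bigr => i _ do rewrite nth_fps_inv_seq //.
by rewrite [f 0%N * _]mulrC divfK // addrC subrK.
Qed.

(* t / (e^t - 1) is the inverse of the series (e^t - 1) / t, whose coefficient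
   of t^n is 1 / (n + 1)!. *)
Definition bernoulli_series : fps := fps_inv (fun n => fps_exp n.+1).

Definition bernoulli (n : nat) : rat := n`!%:R * bernoulli_series n.

Lemma bernoulli_egf :
  fps_mul (fun n => fps_exp n - fps_one n) (fun n => bernoulli n / n`!%:R)
  =1 fps_X.
Proof.
have E n : bernoulli n / n`!%:R = bernoulli_series n.
  by rewrite /bernoulli mulrC mulKf // pnatr_eq0 -lt0n fact_gt0.
case=> [|n]; rewrite /fps_mul big_ord_recr /= subnn.
  by rewrite big_ord0 add0r /fps_exp /fps_one fact0 invr1 subrr mul0r.
rewrite {2}/fps_exp {2}/fps_one fact0 invr1 subrr mul0r addr0.
rewrite -[RHS](@fps_mulV (fun n => fps_exp n.+1) isT n).
apply: eq_bigr => i _; rewrite E subSn ?leq_ord //.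
by rewrite /fps_one subr0.
Qed.

(* The ring of rational numbers whose denominator is prime to p. *)
Definition p_integral (p : nat) : {pred rat} := fun x => coprime `|denq x|%N p.

(* x and y lie in that ring and x - y lies in its ideal generated by m. *)
Definition p_congruent (p : nat) (m x y : rat) : Prop :=
  [/\ x \in p_integral p, y \in p_integral p
    & exists2 z, z \in p_integral p & x - y = m * z].

(* Main.v *)
(* By Staver's identity, for N = p^a the left-hand side equals
   p/3 * 1/2 C(2N, N) * sum_(0 < k < N) (p^(a-1) / (k C(N-1, k)))^2,
   where every summand is p-integral.  With R x k = prod_(0 < i <= k) (1 + x/i)
   one has C(2N, N) = R N N and C(N-1, k)^2 = R (-N) k ^2, and the factors with
   p | i of R (p x) (p j) make up R x j while the remaining ones have product 1
   modulo a high enough power of p; hence the terms with p | k reproduce the sum for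
   p^(a-1), the others vanish modulo p^3, and it suffices to treat a = 1, which
   for p = 2, 3 is a computation.
   For a = 1 and p > 3, expanding R (-p) k modulo p^2 reduces the sum to
   H2 + 2 p D with H2 = sum 1/k^2 and D = sum_(i <= k) 1/(i k^2).  The identity
   sum_k (-1)^k C(n, k) / k^2 = - (H_n^2 + H2_n) / 2 at n = p-1 gives
   3 H2 = 2 p D modulo p^2, and Faulhaber's formula gives D = B_(p-3) modulo p. *)
From HB Require Import structures.
Require Import Defs.
From mathcomp Require Import all_boot all_order all_algebra.
From mathcomp Require Import zify ring lra.
Import Order.TTheory GRing.Theory Num.Theory.
Set Implicit Arguments.
Unset Strict Implicit.
Unset Printing Implicit Defensive.
Local Open Scope ring_scope.

(** * Congruences between p-integral rationals *)

(** Any denominator prime to p will do, reduced or not, so closure proofs can simply multiply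
    denominators. *)
Lemma p_integralP p x :
  reflect (exists2 m : nat, coprime m p & x * m%:R \is a Num.int)
          (x \in p_integral p).
Proof.
apply: (iffP idP) => [px | [m co_mp /intrP[n def_n]]].
  exists `|denq x|%N => //.
  by rewrite natr_absz normr_denq -numqE intr_int.
rewrite unfold_in; apply: coprime_dvdl co_mp.
have /eqP: numq x * m%:Z = n * denq x.
  apply: (@intr_inj rat); rewrite !intrM -def_n numqE.
  by rewrite mulrAC.
move/eqP/(congr1 absz); rewrite !abszM => E.
have: (`|denq x| %| `|numq x| * m)%N by rewrite E dvdn_mull.
by rewrite Gauss_dvdr // coprime_sym coprime_num_den.
Qed.

Fact p_integral_subring p : subring_closed (p_integral p).
Proof.
split=> [|x y|x y].
- by apply/p_integralP; exists 1%N; rewrite ?coprime1n ?mulr1 ?rpred1.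
- move=> /p_integralP[m pm xm] /p_integralP[n pn yn].
  apply/p_integralP; exists (m * n)%N; first by rewrite coprimeMl pm.
  have -> : (x - y) * (m * n)%:R = x * m%:R * n%:R - y * n%:R * m%:R by ring.
  by rewrite rpredB // rpredM ?rpred_nat.
- move=> /p_integralP[m pm xm] /p_integralP[n pn yn].
  apply/p_integralP; exists (m * n)%N; first by rewrite coprimeMl pm.
  have -> : (x * y) * (m * n)%:R = (x * m%:R) * (y * n%:R) by ring.
  by rewrite rpredM.
Qed.
HB.instance Definition _ p :=
  GRing.isSubringClosed.Build rat (p_integral p) (p_integral_subring p).

Lemma p_integral_invn p k : coprime k p -> k%:R^-1 \in p_integral p.
Proof.
move=> pk; apply/p_integralP; exists k => //.
by have [->|k0] := eqVneq (k%:R : rat) 0; rewrite ?mulr0 ?mulVf.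
Qed.

(** If m is prime to p and clears z, the numerator of 1 + p z over m is m plus a multiple of p,
    hence prime to p as well. *)
Lemma p_integral_inv1D p z : prime p -> z \in p_integral p ->
  1 + p%:R * z != 0 /\ (1 + p%:R * z)^-1 \in p_integral p.
Proof.
move=> p_pr /p_integralP[m pm /intrP[n zm]].
have m0 : m%:R != 0 :> rat.
  rewrite pnatr_eq0; apply: contraTneq pm => ->.
  by rewrite /coprime gcd0n neq_ltn prime_gt1 ?orbT.
have e : (1 + p%:R * z) * m%:R = (m%:Z + p%:Z * n)%:~R :> rat.
  by rewrite mulrDl mul1r -mulrA zm intrD intrM.
have co : coprime `|(m%:Z + p%:Z * n)%R|%N p.
  rewrite coprime_sym prime_coprime //; apply/negP => pd.
  have: (p %| (m%:Z + p%:Z * n)%R)%Z by rewrite dvdzE.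
  rewrite rpredDr ?dvdz_mulr // dvdzE /= => pdm.
  by move: pm; rewrite coprime_sym prime_coprime // pdm.
have u0 : 1 + p%:R * z != 0.
  apply/eqP => u0; move: e; rewrite u0 mul0r => /esym/eqP.
  rewrite intr_eq0 => /eqP E; move: co; rewrite E.
  by rewrite /coprime gcd0n; move: (prime_gt1 p_pr); case: (p) => [|[]].
split=> //; apply/p_integralP; exists `|(m%:Z + p%:Z * n)%R|%N => //.
rewrite natr_absz intr_norm -e normrM normr_nat mulrA.
case: (ger0P (1 + _)) => _; rewrite ?mulrN mulVf // ?mulN1r ?mul1r ?rpredN.
all: exact: rpred_nat.
Qed.

(** Only the difference is constrained, unlike in [p_congruent]; [cong_integral] transports
    integrality along a congruence when it is needed. *)
Definition cong (p n : nat) (x y : rat) : Prop :=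
  exists2 z, z \in p_integral p & x - y = p%:R ^+ n * z.

Section Congruence.
Variables (p : nat) (p_prime : prime p).
Implicit Types (m n : nat) (x y z : rat).

Lemma p_neq0 : p%:R != 0 :> rat.
Proof. by rewrite pnatr_eq0 -lt0n prime_gt0. Qed.

Lemma cong_refl n x : cong p n x x.
Proof. by exists 0; rewrite ?rpred0 // subrr mulr0. Qed.

Lemma cong_sym n x y : cong p n x y -> cong p n y x.
Proof. by case=> z zi e; exists (- z); rewrite ?rpredN // mulrN -e opprB. Qed.

Lemma cong_trans n y x z : cong p n x y -> cong p n y z -> cong p n x z.
Proof.
move=> [a ai ea] [b bi eb]; exists (a + b); first exact: rpredD.
by rewrite mulrDr -ea -eb addrA subrK.
Qed.

Lemma congD n x y x' y' :
  cong p n x x' -> cong p n y y' -> cong p n (x + y) (x' + y').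
Proof.
move=> [a ai ea] [b bi eb]; exists (a + b); first exact: rpredD.
by rewrite mulrDr -ea -eb; ring.
Qed.

Lemma congN n x y : cong p n x y -> cong p n (- x) (- y).
Proof.
by case=> z zi e; exists (- z); rewrite ?rpredN // mulrN -e; ring.
Qed.

Lemma congB n x y x' y' :
  cong p n x x' -> cong p n y y' -> cong p n (x - y) (x' - y').
Proof. by move=> cx cy; apply: congD cx (congN cy). Qed.

Lemma cong_sum n (I : Type) (r : seq I) (P : pred I) (F G : I -> rat) :
  (forall i, P i -> cong p n (F i) (G i)) ->
  cong p n (\sum_(i <- r | P i) F i) (\sum_(i <- r | P i) G i).
Proof.
move=> FG; apply: (big_ind2 (cong p n)) => //; first exact: cong_refl.
by move=> *; apply: congD.
Qed.

Lemma cong_sum_nat n a b (F G : nat -> rat) :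
  (forall i, (a <= i < b)%N -> cong p n (F i) (G i)) ->
  cong p n (\sum_(a <= i < b) F i) (\sum_(a <= i < b) G i).
Proof.
by move=> FG; rewrite big_nat [X in cong _ _ _ X]big_nat; apply: cong_sum.
Qed.

Lemma cong_sum_nat0 n a b (F : nat -> rat) :
  (forall i, (a <= i < b)%N -> cong p n (F i) 0) ->
  cong p n (\sum_(a <= i < b) F i) 0.
Proof.
move=> F0; have := cong_sum_nat (G := fun=> 0) F0.
by rewrite [X in cong _ _ _ X]big1.
Qed.

Lemma congW m n x y : (m <= n)%N -> cong p n x y -> cong p m x y.
Proof.
move=> le_mn [z zi e]; exists (p%:R ^+ (n - m) * z).
  by rewrite rpredM ?rpredX ?rpred_nat.
by rewrite mulrA -exprD subnKC.
Qed.

Lemma congM n x y x' y' : x \in p_integral p -> y' \in p_integral p ->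
  cong p n x x' -> cong p n y y' -> cong p n (x * y) (x' * y').
Proof.
move=> xi yi [a ai ea] [b bi eb]; exists (x * b + a * y').
  by rewrite rpredD ?rpredM.
have -> : x * y - x' * y' = x * (y - y') + (x - x') * y' by ring.
by rewrite ea eb; ring.
Qed.

Lemma congMl n c x y : c \in p_integral p ->
  cong p n x y -> cong p n (c * x) (c * y).
Proof.
move=> ci [z zi e]; exists (c * z); first exact: rpredM.
by rewrite -mulrBr e mulrCA.
Qed.

Lemma cong_scale m n x y : cong p n x y ->
  cong p (m + n) (p%:R ^+ m * x) (p%:R ^+ m * y).
Proof.
by case=> z zi e; exists z => //; rewrite -mulrBr e exprD mulrA.
Qed.

Lemma cong_scale1 n x y : cong p n x y -> cong p n.+1 (p%:R * x) (p%:R * y).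
Proof. exact: (@cong_scale 1). Qed.

Lemma cong0 n z : z \in p_integral p -> cong p n (p%:R ^+ n * z) 0.
Proof. by exists z; rewrite ?subr0. Qed.

Lemma cong_integral n x y :
  cong p n x y -> y \in p_integral p -> x \in p_integral p.
Proof.
case=> z zi e yi; rewrite -(subrK y x) e.
by rewrite rpredD ?rpredM ?rpredX ?rpred_nat.
Qed.

Lemma cong_prod1 n (I : Type) (r : seq I) (P : pred I) (F : I -> rat) :
  (forall i, P i -> cong p n (F i) 1) ->
  cong p n (\prod_(i <- r | P i) F i) 1.
Proof.
move=> F1; apply: (big_ind (fun x => cong p n x 1)) => //.
  exact: cong_refl.
move=> x y x1 y1; rewrite -[1](mulr1 1); apply: congM => //.
  by apply: cong_integral x1 _; apply: rpred1.
exact: rpred1.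
Qed.

Lemma cong1_unit n x : cong p n.+1 x 1 -> x != 0 /\ x^-1 \in p_integral p.
Proof.
case=> z zi e.
have -> : x = 1 + p%:R * (p%:R ^+ n * z) by rewrite mulrA -exprS -e; ring.
by apply: p_integral_inv1D => //; rewrite rpredM ?rpredX ?rpred_nat.
Qed.

Lemma congV n x y : x != 0 -> y != 0 ->
  x^-1 \in p_integral p -> y^-1 \in p_integral p ->
  cong p n x y -> cong p n x^-1 y^-1.
Proof.
move=> x0 y0 xi yi [z zi e]; exists (- (x^-1 * y^-1 * z)).
  by rewrite rpredN !rpredM.
have -> : x^-1 - y^-1 = - (x^-1 * y^-1 * (x - y)) by field; rewrite x0 y0.
by rewrite e; ring.
Qed.

Lemma cong1V n x : cong p n.+1 x 1 -> cong p n.+1 x^-1 1.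
Proof.
move=> x1; have [x0 xi] := cong1_unit x1.
by rewrite -[1]invr1; apply: congV; rewrite ?invr1 ?oner_eq0 ?rpred1.
Qed.

Lemma cong_cancel n c x y : c != 0 -> c^-1 \in p_integral p ->
  cong p n (c * x) (c * y) -> cong p n x y.
Proof. by move=> c0 ci /(congMl ci); rewrite !mulKf. Qed.

End Congruence.

(** * Staver's identity *)

Lemma ratn_ge0 n : 0 <= n%:R :> rat.
Proof. exact: ler0n. Qed.

Ltac natr_neq0 := repeat (apply/andP; split); try apply: lt0r_neq0;
  repeat match goal with H : ?T |- _ =>
    lazymatch T with nat => fail | _ => clear H end
  end;
  repeat match goal with n : nat |- _ =>
    let T := type of (ratn_ge0 n) in
    lazymatch goal with _ : T |- _ => fail | _ => pose proof (ratn_ge0 n) end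
  end; lra.

Lemma binr_neq0 n k : (k <= n)%N -> 'C(n, k)%:R != 0 :> rat.
Proof. by rewrite pnatr_eq0 -lt0n bin_gt0. Qed.

Lemma sum_inv_bin_sqr m :
  let A n : rat := \sum_(0 <= k < n.+1) 'C(n, k)%:R ^- 2 in
  2 * (2 * m%:R + 5) * A m.+1 =
  (m%:R + 2) ^+ 3 / (m%:R + 1) ^+ 2 * A m + 6 * (m%:R + 2).
Proof.
move=> A; rewrite {1}/A big_nat_recr //= binn expr1n invr1.
(* G is the certificate that Zeilberger's algorithm finds for the recurrence. *)
pose G k : rat := (2 * k%:R - 3 * (m%:R + 2)) / 'C(m.+1, k)%:R ^+ 2.
have tele k : (0 <= k < m.+1)%N -> G k.+1 - G k =
    2 * (2 * m%:R + 5) / 'C(m.+1, k)%:R ^+ 2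
    - (m%:R + 2) ^+ 3 / (m%:R + 1) ^+ 2 / 'C(m, k)%:R ^+ 2.
  rewrite ltnS => /andP[_ km]; set c : rat := 'C(m.+1, k)%:R.
  have c0 : c != 0 by rewrite binr_neq0 // ltnW.
  have [d md] : exists d, m = (k + d)%N by exists (m - k)%N; rewrite subnKC.
  have c1 : 'C(m.+1, k.+1)%:R = c * (d%:R + 1) / (k%:R + 1) :> rat.
    apply: (mulIf (_ : k.+1%:R != 0)); first by rewrite pnatr_eq0.
    rewrite -natrM mulnC mul_bin_left natrM -/c md -addnS addnC addnK.
    by field; natr_neq0.
  have c2 : 'C(m, k)%:R = c * (d%:R + 1) / (m%:R + 1) :> rat.
    apply: (mulfI (_ : m.+1%:R != 0)); first by rewrite pnatr_eq0.
    rewrite -natrM (mul_bin_down m.+1) natrM -/c.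
    have -> : (m.+1 - k)%N = d.+1 by rewrite md; lia.
    by field; natr_neq0.
  rewrite /G c1 c2 -/c -natr1 md natrD.
  by field; rewrite c0; natr_neq0.
(* The boundary values of [G] contribute 2(m+1), and the term k = m+1 of [A m.+1], split off at the
   start, contributes 2(2m+5); together they give 6(m+2). *)
have := telescope_sumr G (leq0n m.+1).
rewrite (eq_big_nat _ _ tele) sumrB -!mulr_sumr -/(A m).
rewrite /G binn bin0 expr1n divr1 => E.
lra.
Qed.

Lemma central_binS n :
  'C(2 * n.+1, n.+1)%:R
  = 'C(2 * n, n)%:R * (2 * (2 * n%:R + 1)) / (n%:R + 1) :> rat.
Proof.
have e1 : n.+1%:R * 'C(2 * n.+1, n.+1)%:R
    = (2 * n.+1)%:R * 'C((2 * n).+1, n)%:R :> rat.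
  by rewrite -!natrM -mul_bin_diag mulnS.
have e2 : n.+1%:R * 'C((2 * n).+1, n)%:R
    = (2 * n).+1%:R * 'C(2 * n, n)%:R :> rat.
  rewrite -!natrM (mul_bin_diag (2 * n).+1) -(@bin_sub _ n.+1); last by lia.
  by congr (_ * 'C(_, _))%:R; lia.
apply: (mulfI (_ : n.+1%:R != 0)); first by natr_neq0.
rewrite e1 natrM -mulrA e2.
by move: ('C(2 * n, n)%:R : rat) => c; field; natr_neq0.
Qed.

(** Induction on n: the recurrence [sum_inv_bin_sqr] and the ratio [central_binS] make the increment
    of the right-hand side equal to the new summand. *)
Lemma Staver n :
  \sum_(1 <= k < n.+1) 'C(2 * k, k)%:R / k%:R =
  n.+1%:R / 6 * 'C(2 * n.+1, n.+1)%:R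
    * \sum_(1 <= k < n.+1) (k%:R * 'C(n, k)%:R) ^- 2 :> rat.
Proof.
case: n => [|n]; first by rewrite !big_geq // mulr0.
pose A n : rat := \sum_(0 <= k < n.+1) 'C(n, k)%:R ^- 2.
(* This is k C(n+1, k) = (n+1) C(n, k-1) with the index shifted. *)
have -> : \sum_(1 <= k < n.+2) (k%:R * 'C(n.+1, k)%:R) ^- 2
    = A n / (n%:R + 1) ^+ 2.
  rewrite big_add1 /A mulr_suml; apply: eq_big_nat => k _.
  by rewrite -natrM -mul_bin_diag natrM exprMn invfM mulrC natr1.
elim: n => [|n IHn].
  by rewrite big_nat1 /A big_nat1 /=; apply/eqP.
rewrite big_nat_recr //= {}IHn.
have -> : 'C(2 * n.+3, n.+3)%:R
    = 'C(2 * n.+2, n.+2)%:R * (2 * (2 * n%:R + 5)) / (n%:R + 3) :> rat.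
  by rewrite (central_binS n.+2); field; natr_neq0.
have E : 2 * (2 * n%:R + 5) * A n.+1 =
    (n%:R + 2) ^+ 3 / (n%:R + 1) ^+ 2 * A n + 6 * (n%:R + 2).
  exact: sum_inv_bin_sqr.
have -> : A n.+1 = ((n%:R + 2) ^+ 3 / (n%:R + 1) ^+ 2 * A n + 6 * (n%:R + 2))
   / (2 * (2 * n%:R + 5)) by rewrite -E; field; natr_neq0.
by field; natr_neq0.
Qed.

(** * Binomial coefficients as values of the polynomial C(x + k, k) *)

Definition rising (x : rat) k : rat := \prod_(1 <= i < k.+1) (1 + x / i%:R).

Lemma risingS x k : rising x k.+1 = rising x k * (1 + x / k.+1%:R).
Proof. by rewrite /rising big_nat_recr. Qed.

Lemma rising0 x : rising x 0 = 1.
Proof. by rewrite /rising big_geq. Qed.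

Lemma rising_binD n k : rising n%:R k = 'C(n + k, k)%:R.
Proof.
elim: k => [|k IHk]; first by rewrite rising0 addn0 bin0.
apply: (mulfI (_ : k.+1%:R != 0)); first by rewrite pnatr_eq0.
rewrite -natrM addnS -(mul_bin_diag (n + k).+1) natrM /= -IHk risingS.
by rewrite -addSn natrD; field; natr_neq0.
Qed.

(** Both sides vanish from k = n on, the left one because its factor at i = n is 0. *)
Lemma rising_binB n k : (0 < n)%N ->
  rising (- n%:R) k = (-1) ^+ k * 'C(n.-1, k)%:R.
Proof.
case: n => // n _; rewrite /=.
elim: k => [|k IHk]; first by rewrite rising0 bin0 mulr1.
apply: (mulfI (_ : k.+1%:R != 0)); first by rewrite pnatr_eq0.
rewrite mulrCA -natrM mul_bin_left natrM risingS {}IHk.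
have [kn|nk] := leqP k n; last by rewrite bin_small // !(mulr0, mul0r).
by rewrite natrB // exprS; field; natr_neq0.
Qed.

(** * Splitting off the multiples of p *)

(** Induction on n, adding one block of p consecutive indices. A general commutative law serves both
    the products [rising] and the sums [staver_sum]. *)
Lemma big_nat_multiples (R : Type) (idx : R) (op : Monoid.com_law idx)
    (g : nat -> R) p n : (0 < p)%N ->
  \big[op/idx]_(1 <= k < (p * n).+1) g k =
  op (\big[op/idx]_(1 <= j < n.+1) g (p * j)%N)
     (\big[op/idx]_(0 <= l < n) \big[op/idx]_(1 <= r < p) g (p * l + r)%N).
Proof.
case: p => // p _; elim: n => [|n IHn].
  by rewrite muln0 !big_geq // (Monoid.mulm1 op).
rewrite (@big_cat_nat _ _ _ (p.+1 * n).+1) //=; last by nia.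
rewrite IHn [\big[_/_]_(1 <= _ < n.+2) _]big_nat_recr //=.
rewrite [\big[_/_]_(0 <= _ < n.+1) _]big_nat_recr //=.
rewrite -!(Monoid.mulmA op); congr (op _ _).
rewrite [RHS]Monoid.mulmCA; congr (op _ _).
have e : (p.+1 * n.+1 = (p.+1 * n + p).+1)%N by lia.
rewrite e big_nat_recr /=; last by lia.
rewrite Monoid.mulmC; congr (op _ _).
rewrite -[X in \big[_/_]_(X <= _ < _) _]add1n big_addn.
have -> : ((p.+1 * n + p).+1 - p.+1 * n)%N = p.+1 by lia.
by apply: eq_bigr => r _; rewrite addnC.
Qed.

Definition rising_coprime p x n : rat :=
  \prod_(0 <= l < n) \prod_(1 <= r < p) (1 + x / (p * l + r)%:R).

Lemma rising_multiple p x n : (0 < p)%N ->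
  rising (p%:R * x) (p * n) = rising x n * rising_coprime p (p%:R * x) n.
Proof.
move=> p0; rewrite /rising big_nat_multiples //; congr (_ * _).
apply: eq_big_nat => i /andP[i0 _].
have i0' : i%:R != 0 :> rat by rewrite pnatr_eq0 -lt0n.
have p0' : p%:R != 0 :> rat by rewrite pnatr_eq0 -lt0n.
by rewrite natrM; field; rewrite i0' p0'.
Qed.

Section PrimePower.
Variables (p : nat) (p_prime : prime p).
Let p_gt0 := prime_gt0 p_prime.

Lemma coprime_residue l r : (0 < r < p)%N -> coprime (p * l + r) p.
Proof.
move=> /andP[r0 rp]; rewrite coprime_sym prime_coprime //.
by rewrite dvdn_addr ?dvdn_mulr // gtnNdvd.
Qed.

(** Each factor is 1 modulo p^(b+1). For p = 3 one more power is gained by pairing the factors at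
    3l+1 and 3l+2. *)
Lemma rising_coprime_cong b z n : z \in p_integral p ->
  cong p (b.+1 + (p == 3%N)) (rising_coprime p (p%:R ^+ b.+1 * z) n) 1.
Proof.
move=> zi; apply: cong_prod1 => l _; case: eqP => [p3|_].
  have zi3 : z \in p_integral 3 by rewrite -p3.
  rewrite p3 big_ltn // big_nat1.
  have i1 : (3 * l + 1)%:R^-1 \in p_integral 3.
    by rewrite p_integral_invn // -p3 coprime_residue ?p3.
  have i2 : (3 * l + 2)%:R^-1 \in p_integral 3.
    by rewrite p_integral_invn // -p3 coprime_residue ?p3.
  (* The two reciprocals add up to 3(2l+1) / ((3l+1)(3l+2)), and the quadratic term carries 3^(2b+2)
     = 3^(b+2) 3^b. *)
  exists (z * (2 * l%:R + 1) * (3 * l + 1)%:R^-1 * (3 * l + 2)%:R^-1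
      + 3%:R ^+ b * z * z * (3 * l + 1)%:R^-1 * (3 * l + 2)%:R^-1).
    by rewrite rpredD // !rpredM ?rpredD ?rpredM ?rpredX ?rpred_nat ?rpred1.
  have n1 : (3 * l + 1)%:R != 0 :> rat by rewrite pnatr_eq0 addn1.
  have n2 : (3 * l + 2)%:R != 0 :> rat by rewrite pnatr_eq0 addn2.
  have D k : (3 * l + k)%:R = 3 * l%:R + k%:R :> rat by rewrite natrD natrM.
  rewrite [(b.+1 + _)%N]addn1 !exprS; rewrite !D in n1 n2 *.
  by field; rewrite n1 n2.
rewrite addn0 big_nat; apply: cong_prod1 => r rp.
exists (z / (p * l + r)%:R); last by ring.
by rewrite rpredM // p_integral_invn // coprime_residue.
Qed.

(** Induction by Pascal's rule, since p divides C(p^a, k+1): otherwise p^a, a divisor of (k+1)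
    C(p^a, k+1), would divide k+1. *)
Lemma coprime_bin_pred a k : (k < p ^ a)%N -> coprime 'C((p ^ a).-1, k) p.
Proof.
elim: k => [|k IHk] ka; first by rewrite bin0 coprime1n.
have pa0 : (0 < p ^ a)%N by rewrite expn_gt0 p_gt0.
have: (p %| 'C((p ^ a).-1.+1, k.+1))%N.
  rewrite prednK //; apply: contraLR ka.
  rewrite -leqNgt -prime_coprime // => co.
  apply: dvdn_leq => //; rewrite -(@Gauss_dvdl _ _ 'C(p ^ a, k.+1)).
    by rewrite -mul_bin_diag dvdn_mulr.
  exact: coprimeXl.
rewrite binS => pd; rewrite coprime_sym prime_coprime //; apply/negP => pd1.
move: pd; rewrite dvdn_addr // => pd2.
move: (IHk (ltnW ka)); rewrite coprime_sym prime_coprime // pd2 //.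
Qed.

(* For k = p ^ a the product is 0, and so is its inverse. *)
Lemma rising_pow_integral_inv a k : (k <= p ^ a)%N ->
  (rising (- (p ^ a)%:R) k)^-1 \in p_integral p.
Proof.
have pa0 : (0 < p ^ a)%N by rewrite expn_gt0 p_gt0.
rewrite rising_binB // leq_eqVlt => /predU1P[->|ka].
  by rewrite bin_small ?mulr0 ?invr0 ?rpred0 // prednK.
rewrite invfM -exprVn invrN1 rpredM ?rpredX ?rpredN ?rpred1 //.
by rewrite p_integral_invn // coprime_bin_pred.
Qed.

(** Up to sign this is p^a / (k C(N-1, k)) for N = p^(a+1): the exponent is shifted by one. *)
Definition staver_term a k : rat :=
  p%:R ^+ a / (k%:R * rising (- (p ^ a.+1)%:R) k).

(** For k < p^(a+1) the p-part of k is at most p^a and cancels; for k = p^(a+1) the term is 0. *)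
Lemma staver_term_integral a k : (0 < k <= p ^ a.+1)%N ->
  staver_term a k \in p_integral p.
Proof.
have pa0 : (0 < p ^ a.+1)%N by rewrite expn_gt0 p_gt0.
case/andP=> k0; rewrite leq_eqVlt => /predU1P[->|ka].
  rewrite /staver_term rising_binB // bin_small ?prednK //.
  by rewrite !mulr0 invr0 mulr0 rpred0.
rewrite /staver_term invfM mulrA rpredM //; last first.
  by rewrite rising_pow_integral_inv // ltnW.
have [m pm ->] := pfactor_coprime p_prime k0.
set e := logn p k; have ea : (e <= a)%N.
  rewrite -ltnS -(@ltn_exp2l p) ?prime_gt1 //; apply: leq_ltn_trans ka.
  by apply: dvdn_leq => //; rewrite pfactor_dvdnn.
rewrite -(subnK ea) natrM natrX invfM exprD.
have -> : p%:R ^+ (a - e) * p%:R ^+ e * (m%:R^-1 / p%:R ^+ e)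
   = p%:R ^+ (a - e) * m%:R^-1 :> rat.
  rewrite -mulrA [X in _ * X]mulrCA mulfV ?mulr1 // expf_neq0 //.
  exact: p_neq0.
rewrite rpredM ?rpredX ?rpred_nat // p_integral_invn //.
by rewrite coprime_sym.
Qed.

Definition half_central n : rat := rising n%:R n / 2.

(** Central binomial coefficients are even, which matters for p = 2. *)
Lemma half_central_integral n : (0 < n)%N -> half_central n \in p_integral p.
Proof.
case: n => // n _; rewrite /half_central rising_binD.
suff -> : 'C(n.+1 + n.+1, n.+1)%:R = 2 * 'C((2 * n).+1, n)%:R :> rat.
  by rewrite mulrC mulKf // rpred_nat.
apply: (mulfI (_ : n.+1%:R != 0)); first by rewrite pnatr_eq0.
rewrite mulrCA -!natrM; congr _%:R.
have -> : (n.+1 + n.+1 = (2 * n).+2)%N by lia.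
by rewrite -mul_bin_diag /=; lia.
Qed.

(* The term at k = p ^ a.+1 is 0 because x / 0 = 0; including it lets the range
   split evenly into residues modulo p. *)
Definition staver_sum a : rat :=
  half_central (p ^ a.+1) * \sum_(1 <= k < (p ^ a.+1).+1) staver_term a k ^+ 2.

(** Staver's identity at N - 1. The given p^a and the p^a in N = p p^a are absorbed into the squared
    terms. *)
Lemma central_sumE a :
  p%:R ^+ a * \sum_(1 <= k < (p ^ a.+1)%N) 'C(2 * k, k)%:R / k%:R
  = p%:R / 3 * staver_sum a.
Proof.
have pa0 : (0 < p ^ a.+1)%N by rewrite expn_gt0 p_gt0.
rewrite /staver_sum /half_central; set N := (p ^ a.+1)%N in pa0 *.
rewrite -{1}(prednK pa0) Staver prednK // big_nat_recr //=.
rewrite rising_binD addnn -mul2n.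
have -> : staver_term a N ^+ 2 = 0.
  rewrite /staver_term -/N rising_binB // bin_small ?prednK //.
  by rewrite !mulr0 invr0 mulr0 expr0n.
have -> : \sum_(1 <= k < N) staver_term a k ^+ 2
   = p%:R ^+ a ^+ 2 * \sum_(1 <= k < N) (k%:R * 'C(N.-1, k)%:R) ^- 2.
  rewrite mulr_sumr; apply: eq_bigr => k _.
  rewrite /staver_term -/N rising_binB // expr_div_n.
  by rewrite mulrCA [(_ * (_ * _)) ^+ 2]exprMn sqrr_sign mul1r.
by rewrite {1}/N natrX exprS; field.
Qed.

End PrimePower.

(** * Reduction to a = 1 *)

(** The factor p/3 supplies one power of p, except for p = 3, where it is 1; this is why the
    exponent 2 + (p == 3) recurs. *)
Lemma cong_third p x y : prime p -> cong p (2 + (p == 3%N)) x y ->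
  cong p 3 (p%:R / 3 * x) (p%:R / 3 * y).
Proof.
move=> p_pr; case: eqP => [-> | /eqP p3]; first by rewrite mulfV // !mul1r.
rewrite addn0 -!mulrA => c; apply: cong_scale1; apply: congMl c.
by rewrite p_integral_invn // coprime_sym prime_coprime // dvdn_prime2.
Qed.

Lemma cong3_inv_sqr n : coprime n 3 -> cong 3 1 (n%:R ^- 2) 1.
Proof.
move=> n3; apply: (@cong1V 3 isT 0); rewrite (divn_eq n 3).
set q := (n %/ 3)%N.
have [->|->] : (n %% 3 = 1 \/ n %% 3 = 2)%N.
  have := ltn_pmod n (isT : (0 < 3)%N); move: n3.
  by rewrite coprime_sym -coprime_modr; case: (n %% 3)%N => [|[|[]]] //; auto.
- exists (3 * q%:R ^+ 2 + 2 * q%:R); last by rewrite natrD natrM; ring.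
  by rewrite rpredD ?rpredM ?rpredX ?rpred_nat.
- exists (3 * q%:R ^+ 2 + 4 * q%:R + 1); last by rewrite natrD natrM; ring.
  by rewrite !rpredD ?rpredM ?rpredX ?rpred_nat.
Qed.

Section Step.
Variables (p : nat) (p_prime : prime p).
Let p_gt0 := prime_gt0 p_prime.

Lemma staver_term_coprime a k : coprime k p -> (k <= p ^ a.+1)%N ->
  exists2 n, coprime n p & staver_term p a k ^+ 2 = p%:R ^+ (2 * a) * n%:R ^- 2.
Proof.
move=> kp; rewrite leq_eqVlt => /predU1P[k_eq|ka].
  move: kp; rewrite k_eq coprime_pexpl //.
  by rewrite /coprime gcdnn gtn_eqF ?prime_gt1.
exists (k * 'C((p ^ a.+1).-1, k))%N.
  by rewrite coprimeMl kp coprime_bin_pred.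
rewrite /staver_term rising_binB ?expn_gt0 ?p_gt0 // natrM expr_div_n.
by rewrite mulrCA [(_ * (_ * _)) ^+ 2]exprMn sqrr_sign mul1r mulnC exprM.
Qed.

(** Each squared term is p^(2a+2) times a p-integral number. For p = 3 and a = 0 this is one power
    short; but each term is then 3^(2a+2) modulo 3^(2a+3), and the number of terms is divisible by
    3. *)
Lemma coprime_terms_cong0 a :
  cong p (2 + (p == 3%N))
    (\sum_(0 <= l < p ^ a.+1) \sum_(1 <= r < p)
        staver_term p a.+1 (p * l + r) ^+ 2) 0.
Proof.
have inrange l r : (0 <= l < p ^ a.+1)%N -> (1 <= r < p)%N ->
    coprime (p * l + r) p /\ (p * l + r <= p ^ a.+2)%N.
  move=> /= la rp; split; first exact: coprime_residue.
  by rewrite [(p ^ a.+2)%N]expnS; case/andP: rp => _ rp; nia.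
case: eqP => [p3|_].
  apply: (@cong_trans _ _
    (\sum_(0 <= l < p ^ a.+1) \sum_(1 <= r < p) p%:R ^+ (2 * a.+1))).
    apply: cong_sum_nat => l la; apply: cong_sum_nat => r rp.
    have [co le] := inrange _ _ la rp.
    have [n np ->] := staver_term_coprime co le.
    apply: (@congW _ _ (2 * a.+1 + 1)); first by lia.
    rewrite -[X in cong _ _ _ X]mulr1; apply: cong_scale.
    by rewrite p3; apply: cong3_inv_sqr; rewrite -p3.
  rewrite sumr_const_nat sumr_const_nat subn0 -mulrnA.
  apply: (@congW _ _ (2 * a.+1 + 1)); first by lia.
  exists ((p - 1) * p ^ a)%:R; first exact: rpred_nat.
  rewrite subr0 -[LHS]mulr_natr expnS (mulnCA _ p) natrM.
  rewrite (exprD _ (2 * a.+1) 1) expr1.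
  by rewrite mulrA.
apply: cong_sum_nat0 => l la; apply: cong_sum_nat0 => r rp.
have [co le] := inrange _ _ la rp.
have [n np ->] := staver_term_coprime co le.
rewrite mulnS exprD -mulrA; apply: cong0.
by rewrite rpredM ?rpredX ?rpred_nat // -exprVn rpredX // p_integral_invn.
Qed.

(** [rising_multiple] at N and -N relates the central factor and the terms at k = p j to those of
    the previous level, up to factors congruent to 1; the other terms drop out. *)
Lemma staver_sum_step a :
  cong p (2 + (p == 3%N)) (staver_sum p a.+1) (staver_sum p a).
Proof.
set d := nat_of_bool (p == 3%N); set N := (p ^ a.+1)%N.
have N0 : (0 < N)%N by rewrite expn_gt0 p_gt0.
have NE : N%:R = p%:R * p%:R ^+ a :> rat by rewrite natrX exprS.
have pNE : (p ^ a.+2 = p * N)%N by rewrite expnS.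
pose E x j := rising_coprime p x j.
have E1 z j : z \in p_integral p -> cong p (2 + d) (E (p%:R * (N%:R * z)) j) 1.
  move=> zi; rewrite NE.
  (* The argument p N contains p^2 already for a = 0. *)
  have -> : p%:R * (p%:R * p%:R ^+ a * z) = p%:R ^+ 2 * (p%:R ^+ a * z) by ring.
  by apply: rising_coprime_cong; rewrite ?rpredM ?rpredX ?rpred_nat.
have Ep : cong p (2 + d) (E (p%:R * N%:R) N) 1.
  by have := E1 1 N (rpred1 _); rewrite mulr1.
have En j : cong p (2 + d) (E (p%:R * - N%:R) j) 1.
  by have := E1 (-1) j; rewrite mulrN1; apply; rewrite rpredN rpred1.
have half : half_central (p ^ a.+2) = half_central N * E (p%:R * N%:R) N.
  by rewrite /half_central pNE natrM rising_multiple // -/(E _ _) mulrAC.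
have term j : (0 < j)%N -> staver_term p a.+1 (p * j)
    = staver_term p a j / E (p%:R * - N%:R) j.
  move=> j0; rewrite /staver_term pNE [(p * N)%:R]natrM -mulrN.
  rewrite rising_multiple // -/(E _ _).
  rewrite natrM exprS -[p%:R * j%:R * _]mulrA (mulrA j%:R) -mulf_div.
  by rewrite divff ?p_neq0 // mul1r invfM mulrA.
have Wi : half_central N \in p_integral p by apply: half_central_integral.
rewrite /staver_sum half pNE big_nat_multiples // -mulrA.
apply: congMl => //; rewrite -[X in cong _ _ _ X]mul1r.
have sum_i : \sum_(1 <= k < N.+1) staver_term p a k ^+ 2 \in p_integral p.
  rewrite big_nat rpred_sum // => k kN.
  by rewrite rpredX // staver_term_integral.
apply: congM => //; first by apply: cong_integral Ep (rpred1 _).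
rewrite -[X in cong _ _ _ X]addr0; apply: congD; last first.
  exact: coprime_terms_cong0.
apply: cong_sum_nat => j jN; case/andP: (jN) => j0 _; rewrite term //.
rewrite expr_div_n -[X in cong _ _ _ X]mulr1; apply: congMl.
  by rewrite rpredX // staver_term_integral.
rewrite -exprVn -(expr1n _ 2); apply: congM; rewrite ?rpred1 //.
- by have [] := cong1_unit p_prime (En j).
- exact: cong1V.
- exact: cong1V.
Qed.

Lemma central_sum_reduction a :
  cong p 3
    (p%:R ^+ a * \sum_(1 <= k < (p ^ a.+1)%N) 'C(2 * k, k)%:R / k%:R)
    (\sum_(1 <= k < p) 'C(2 * k, k)%:R / k%:R).
Proof.
elim: a => [|a IHa].
  by rewrite mul1r expn1; apply: cong_refl.
apply: cong_trans IHa; rewrite !central_sumE //.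
by apply: cong_third => //; apply: staver_sum_step.
Qed.

End Step.

(** * Bernoulli numbers and harmonic sums *)

Lemma factr_neq0 n : n`!%:R != 0 :> rat.
Proof. by rewrite pnatr_eq0 -lt0n fact_gt0. Qed.

Lemma bernoulli_rec n :
  \sum_(0 <= i < n) 'C(n, i)%:R * bernoulli i = (n == 1%N)%:R.
Proof.
have := bernoulli_egf n; rewrite /fps_mul big_ord_recr /= subnn.
rewrite {2}/fps_exp {2}/fps_one fact0 invr1 subrr mul0r addr0 => E.
have -> : (n == 1%N)%:R = n`!%:R * fps_X n.
  by rewrite /fps_X; case: eqP => [->|_]; rewrite ?mulr0 ?mulr1.
rewrite -E big_mkord mulr_sumr; apply: eq_bigr => i _.
rewrite -(bin_fact (ltnW (ltn_ord i))) /fps_exp /fps_one.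
rewrite subn_eq0 leqNgt ltn_ord subr0 !natrM.
by field; rewrite !factr_neq0.
Qed.

(** Both sides are the multinomial coefficient n! / (r! s! t!) with t = n - r - s. *)
Lemma mul_bin_bin n r s : (r + s <= n)%N ->
  ('C(n, r) * 'C(n - r, s) = 'C(n, s) * 'C(n - s, r))%N.
Proof.
move=> rs; set t := (n - (r + s))%N.
have f0 : (0 < r`! * s`! * t`!)%N by rewrite !muln_gt0 !fact_gt0.
apply/eqP; rewrite -(eqn_pmul2r f0); apply/eqP.
have r1 : (r <= n)%N by lia.
have s1 : (s <= n)%N by lia.
have r2 : (r <= n - s)%N by lia.
have s2 : (s <= n - r)%N by lia.
have E1 := bin_fact r1; have E2 := bin_fact s1.
have := bin_fact r2; have := bin_fact s2.
have -> : (n - r - s = t)%N by lia.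
have -> : (n - s - r = t)%N by lia.
move=> E3 E4; transitivity n`!.
  by rewrite -E1 -E3; ring.
by rewrite -E2 -E4; ring.
Qed.

(** Induction on k: expand the powers of k+1 and exchange sums, so that [bernoulli_rec] leaves only
    the increment (m+1) k^m. *)
Lemma Faulhaber m k :
  m.+1%:R * \sum_(0 <= i < k) i%:R ^+ m
  = \sum_(0 <= r < m.+1) 'C(m.+1, r)%:R * bernoulli r * k%:R ^+ (m.+1 - r).
Proof.
elim: k => [|k IHk].
  rewrite big_geq // mulr0 big_nat big1 // => r /andP[_ rm].
  by rewrite expr0n subn_eq0 leqNgt rm mulr0.
rewrite big_nat_recr //= mulrDr {}IHk; set n := m.+1.
have dif r : (0 <= r < n)%N -> k.+1%:R ^+ (n - r) =
    k%:R ^+ (n - r)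
    + \sum_(0 <= s < n | (s < n - r)%N) 'C(n - r, s)%:R * k%:R ^+ s :> rat.
  move=> _; rewrite -natr1 addrC exprDn big_ord_recr /= subnn expr0 mul1r binn.
  rewrite mulr1n addrC; congr (_ + _).
  rewrite -(@big_nat_widen _ _ _ 0 (n - r) n xpredT) ?leq_subr // big_mkord.
  by apply: eq_bigr => s _; rewrite expr1n mul1r mulr_natl.
(* The guard s + r < n replaces a bound depending on r, so that the sums can be exchanged. *)
rewrite [RHS](eq_big_nat _ _ (F2 := fun r =>
   'C(n, r)%:R * bernoulli r * k%:R ^+ (n - r) +
   \sum_(0 <= s < n) if (s + r < n)%N then
     'C(n, s)%:R * k%:R ^+ s * ('C(n - s, r)%:R * bernoulli r) else 0));
  last first.
  move=> r rn; rewrite dif // mulrDr; congr (_ + _).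
  rewrite big_mkcond mulr_sumr; apply: eq_big_nat => s sn.
  have -> : (s < n - r)%N = (s + r < n)%N by lia.
  case: ifP => sr; last by rewrite mulr0.
  have := @mul_bin_bin n r s; rewrite addnC (ltnW sr) => /(_ isT).
  move/(congr1 (fun x => x%:R : rat)); rewrite !natrM => E.
  transitivity ('C(n, r)%:R * 'C(n - r, s)%:R * bernoulli r * k%:R ^+ s).
    by ring.
  by rewrite E; ring.
rewrite big_split /=; congr (_ + _); rewrite exchange_big_nat /=.
rewrite (eq_big_nat _ _ (F2 := fun s =>
   'C(n, s)%:R * k%:R ^+ s * (n - s == 1)%N%:R)); last first.
  move=> s sn; rewrite -bernoulli_rec mulr_sumr.
  rewrite (@big_nat_widen _ _ _ 0 (n - s) n xpredT) ?leq_subr //.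
  rewrite [RHS]big_mkcond; apply: eq_big_nat => r rn.
  by have -> : (s + r < n)%N = (r < n - s)%N by lia.
rewrite big_nat_recr //= subSnn mulr1 big_nat big1 ?add0r ?binSn //.
move=> s /= sm; have -> : (n - s == 1)%N = false by lia.
by rewrite mulr0.
Qed.

(** * Harmonic numbers and alternating binomial sums *)

Definition harmonic e n : rat := \sum_(1 <= k < n.+1) k%:R ^- e.

Lemma harmonicS e n : harmonic e n.+1 = harmonic e n + n.+1%:R ^- e.
Proof. by rewrite /harmonic big_nat_recr. Qed.

Definition alt_bin_sum e n : rat :=
  \sum_(1 <= k < n.+1) (-1) ^+ k * 'C(n, k)%:R * k%:R ^- e.

Lemma alt_bin_sum0 n : alt_bin_sum 0 n.+1 = -1.
Proof.
have := exprDn (1 : rat) (-1) n.+1; rewrite subrr expr0n /=.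
rewrite big_ord_recl /= bin0 mulr1n expr1n mul1r expr0 => /eqP.
rewrite eq_sym addrC addr_eq0 => /eqP E; rewrite /alt_bin_sum -[RHS]E.
rewrite big_add1 big_mkord; apply: eq_bigr => i _.
by rewrite /= /bump add1n expr1n mul1r expr0 invr1 mulr1 mulr_natr.
Qed.

(** From C(n, k) = (1 - k/(n+1)) C(n+1, k): the factor k lowers the exponent by one. *)
Lemma alt_bin_sumS e n :
  alt_bin_sum e.+1 n.+1 = alt_bin_sum e.+1 n + alt_bin_sum e n.+1 / n.+1%:R.
Proof.
have -> : alt_bin_sum e.+1 n =
    \sum_(1 <= k < n.+2) (-1) ^+ k * 'C(n, k)%:R * k%:R ^- e.+1.
  by rewrite big_nat_recr //= bin_small // mulr0 mul0r addr0.
rewrite /alt_bin_sum mulr_suml -big_split /=.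
apply: eq_big_nat => -[|k] // _.
have -> : 'C(n, k.+1)%:R
    = 'C(n.+1, k.+1)%:R - k.+1%:R * 'C(n.+1, k.+1)%:R / n.+1%:R :> rat.
  rewrite -natrM -(mul_bin_diag n.+1) natrM mulrAC mulfV ?pnatr_eq0 // mul1r.
  by rewrite binS natrD addrK.
rewrite [k.+1%:R ^+ e.+1]exprSr invfM; move: (k.+1%:R ^- e : rat) => x.
by field; natr_neq0.
Qed.

Lemma alt_bin_sum1 n : alt_bin_sum 1 n = - harmonic 1 n.
Proof.
elim: n => [|n IHn]; first by rewrite /alt_bin_sum /harmonic !big_geq ?oppr0.
by rewrite alt_bin_sumS IHn alt_bin_sum0 harmonicS opprD mulN1r.
Qed.

Lemma alt_bin_sum2 n :
  2 * alt_bin_sum 2 n = - (harmonic 1 n ^+ 2 + harmonic 2 n).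
Proof.
elim: n => [|n IHn].
  by rewrite /alt_bin_sum /harmonic !big_geq // mulr0 expr0n addr0 oppr0.
rewrite alt_bin_sumS mulrDr IHn alt_bin_sum1 !harmonicS.
by field; natr_neq0.
Qed.

(** * The case a = 1, p > 3 *)

Lemma prime_gt4 p : prime p -> p <> 2%N -> p <> 3%N -> (4 < p)%N.
Proof. by case: p => [|[|[|[|[|p]]]]]. Qed.

Section LargePrime.
Variables (p : nat) (p_prime : prime p) (p_gt4 : (4 < p)%N).

Lemma coprime_lt_prime k : (0 < k < p)%N -> coprime k p.
Proof.
by move=> /andP[k0 kp]; rewrite coprime_sym prime_coprime // gtnNdvd.
Qed.

Lemma invn_integral k : (0 < k < p)%N -> k%:R^-1 \in p_integral p.
Proof. by move=> kp; rewrite p_integral_invn // coprime_lt_prime. Qed.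

Lemma natr_lt_prime_neq0 k : (0 < k < p)%N -> k%:R != 0 :> rat.
Proof. by case/andP=> k0 _; rewrite pnatr_eq0 -lt0n. Qed.

(** Solving [bernoulli_rec] at n+1 for the last term divides only by n+1 < p. *)
Lemma bernoulli_integral n : (n.+1 < p)%N -> bernoulli n \in p_integral p.
Proof.
elim/ltn_ind: n => n IHn np.
have := bernoulli_rec n.+1; rewrite big_nat_recr //= binSn => E.
have -> : bernoulli n = n.+1%:R^-1 *
    ((n.+1 == 1%N)%:R - \sum_(0 <= i < n) 'C(n.+1, i)%:R * bernoulli i).
  by rewrite -E [X in _ * X]addrC addKr mulKf // pnatr_eq0.
rewrite rpredM ?invn_integral // rpredB ?rpred_nat // big_nat rpred_sum //.
move=> i /andP[_ lt_in]; rewrite rpredM ?rpred_nat // IHn //; lia.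
Qed.

Lemma cong_nat m n : m = n %[mod p] -> cong p 1 m%:R n%:R.
Proof.
move=> mn; exists ((m %/ p)%N%:R - (n %/ p)%N%:R).
  by rewrite rpredB ?rpred_nat.
rewrite {1}(divn_eq m p) {1}(divn_eq n p) mn !natrD !natrM; ring.
Qed.

Lemma cong_fermat k : (0 < k < p)%N -> cong p 1 (k%:R ^+ p.-1) 1.
Proof.
move=> kp; have k0 := natr_lt_prime_neq0 kp.
apply: (cong_cancel k0 (invn_integral kp)).
rewrite mulr1 -exprS prednK ?prime_gt0 // -natrX; apply: cong_nat.
exact: fermat_little.
Qed.

Lemma cong_inv_exp e k : (e < p)%N -> (0 < k < p)%N ->
  cong p 1 (k%:R ^- e) (k%:R ^+ (p.-1 - e)).
Proof.
move=> ep kp; have k0 := natr_lt_prime_neq0 kp.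
apply: cong_sym; rewrite -[X in cong _ _ _ X]mul1r.
rewrite expfB_cond; last by rewrite (negbTE k0); lia.
by apply: congM; rewrite -?exprVn ?rpredX ?rpred_nat ?invn_integral //;
   [exact: cong_fermat | exact: cong_refl].
Qed.

(** In Faulhaber's formula at p every term contains a positive power of p, and e+1 and the Bernoulli
    numbers involved cause no denominator p. *)
Lemma power_sum_cong0 e : (0 < e < p.-1)%N ->
  cong p 1 (\sum_(1 <= k < p) k%:R ^+ e) 0.
Proof.
move=> /andP[e0 ep]; have e1p : (0 < e.+1 < p)%N by lia.
apply: (cong_cancel (natr_lt_prime_neq0 e1p) (invn_integral e1p)).
have -> : \sum_(1 <= k < p) k%:R ^+ e = \sum_(0 <= k < p) k%:R ^+ e :> rat.
  by rewrite [RHS]big_ltn ?prime_gt0 // expr0n eqn0Ngt e0 add0r.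
rewrite Faulhaber mulr0; apply: cong_sum_nat0 => r /andP[_ re].
have -> : (e.+1 - r = (e - r).+1)%N by lia.
exists ('C(e.+1, r)%:R * bernoulli r * p%:R ^+ (e - r)); last first.
  by rewrite subr0 exprS; ring.
rewrite rpredM ?rpredX ?rpred_nat // rpredM ?rpred_nat //.
by apply: bernoulli_integral; lia.
Qed.

Lemma harmonic_cong0 e : (0 < e < p.-1)%N -> cong p 1 (harmonic e p.-1) 0.
Proof.
move=> ep; rewrite /harmonic prednK ?prime_gt0 //.
apply: cong_trans (@power_sum_cong0 (p.-1 - e) _); last by lia.
by apply: cong_sum_nat => k kp; apply: cong_inv_exp => //; lia.
Qed.

Lemma harmonic_integral e n : (n < p)%N -> harmonic e n \in p_integral p.
Proof.
move=> np; rewrite /harmonic big_nat rpred_sum // => k kn.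
by rewrite -exprVn rpredX // invn_integral //; lia.
Qed.

Definition nested_sum : rat :=
  \sum_(1 <= k < p) harmonic 1 k * k%:R ^- 2.

(** Multiply by p-1, replace 1/i by i^(p-2) and apply Faulhaber's formula to the sum over i < k.
    Summing over k then kills every Bernoulli index except p-3. *)
Lemma nested_sum_cong : cong p 1 nested_sum (bernoulli (p - 3)).
Proof.
have p1 : (0 < p.-1 < p)%N by lia.
have inv2 k : (1 <= k < p)%N -> k%:R ^- 2 \in p_integral p.
  by move=> kp; rewrite -exprVn rpredX // invn_integral.
pose B r : rat := 'C(p.-1, r)%:R * bernoulli r.
have Bi r : (r < p.-1)%N -> B r \in p_integral p.
  by move=> rp; rewrite rpredM ?rpred_nat // bernoulli_integral //; lia.
apply: (cong_cancel (natr_lt_prime_neq0 p1) (invn_integral p1)).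
apply: (@cong_trans _ _ (\sum_(1 <= k < p) \sum_(0 <= r < p.-1)
    B r * (k%:R ^+ (p.-1 - r) * k%:R ^- 2))).
  (* The diagonal i = k gives [harmonic 3 p.-1], which vanishes modulo p because 3 < p-1. *)
  have -> : p.-1%:R * nested_sum = p.-1%:R * \sum_(1 <= k < p)
      (\sum_(1 <= i < k) i%:R^-1) * k%:R ^- 2 + p.-1%:R * harmonic 3 p.-1.
    rewrite -mulrDr /harmonic prednK ?prime_gt0 // -big_split /=; congr (_ * _).
    apply: eq_big_nat => k /andP[k0 _]; rewrite /harmonic big_nat_recr //=.
    rewrite mulrDl -invfM -exprD; congr (_ * _ + _).
  rewrite -[X in cong _ _ _ X]addr0; apply: congD; last first.
    rewrite -[X in cong _ _ _ X](mulr0 p.-1%:R); apply: congMl.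
      exact: rpred_nat.
    by apply: harmonic_cong0; lia.
  rewrite mulr_sumr; apply: cong_sum_nat => k kp.
  have -> : \sum_(0 <= r < p.-1) B r * (k%:R ^+ (p.-1 - r) * k%:R ^- 2)
      = p.-1%:R * (\sum_(0 <= i < k) i%:R ^+ (p.-1 - 1)) * k%:R ^- 2.
    rewrite /B; have [m ->] : exists m, p.-1 = m.+1 by exists p.-2; lia.
    rewrite subSS subn0 Faulhaber mulr_suml; apply: eq_bigr => r _.
    by rewrite mulrA.
  rewrite mulrA; apply: congM; rewrite ?inv2 //; last exact: cong_refl.
    rewrite rpredM ?rpred_nat // big_nat rpred_sum // => i ik.
    by rewrite invn_integral //; lia.
  apply: congMl; first exact: rpred_nat.
  rewrite [X in cong _ _ _ X]big_ltn; last by lia.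
  rewrite expr0n (_ : _ == 0%N = false); last by lia.
  rewrite add0r; apply: cong_sum_nat => i ik.
  by apply: (@cong_inv_exp 1); lia.
rewrite exchange_big_nat /=.
have inner r : (r < p.-2)%N ->
    \sum_(1 <= k < p) B r * (k%:R ^+ (p.-1 - r) * k%:R ^- 2)
    = B r * \sum_(1 <= k < p) k%:R ^+ (p - 3 - r).
  move=> rp; rewrite mulr_sumr; apply: eq_big_nat => k kp; congr (_ * _).
  have -> : (p.-1 - r = (p - 3 - r) + 2)%N by lia.
  by rewrite exprD mulfK // expf_neq0 // natr_lt_prime_neq0.
have pE : p.-1 = (p - 3).+2 by lia.
(* The indices r = p-3 and r = p-2 are split off: there the exponent of k is 0, giving p-1 equal
   terms, and -1, giving [harmonic 1 p.-1]. *)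
rewrite {1}pE !big_nat_recr //= -[X in cong _ _ _ X]addr0; apply: congD.
  rewrite -[X in cong _ _ _ X]add0r; apply: congD.
    apply: cong_sum_nat0 => r rp; rewrite inner; last by lia.
    rewrite -[X in cong _ _ _ X](mulr0 (B r)); apply: congMl.
      by apply: Bi; lia.
    by apply: power_sum_cong0; lia.
  rewrite inner; last by lia.
  rewrite subnn sumr_const_nat subn1 [X in cong _ _ X _]mulrC.
  apply: congMl; first exact: rpred_nat.
  rewrite -[X in cong _ _ _ X]mul1r; apply: congM; rewrite ?rpred_nat //.
  - by apply: bernoulli_integral; lia.
  - apply: (@cong_cancel _ _ 2) => //; first by apply: invn_integral; lia.
    (* C(p-1, 2) is 1 modulo p, since (p-1)(p-2) - 2 = p(p-3). *)
    exists (p%:R - 3); first by rewrite rpredB ?rpred_nat.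
    have -> : (p - 3 = p.-1 - 2)%N by lia.
    rewrite bin_sub; last by lia.
    rewrite -natrM (mul_bin_left _ 1) bin1 natrM expr1.
    have -> : p = (p - 3).+3 by lia.
    rewrite subn1 /=; ring.
  - exact: cong_refl.
rewrite -mulr_sumr -[X in cong _ _ _ X](mulr0 (B (p - 3).+1)); apply: congMl.
  by apply: Bi; lia.
apply: cong_trans (harmonic_cong0 (e := 1) _); last by lia.
rewrite /harmonic prednK ?prime_gt0 //; apply: cong_sum_nat => k kp.
have -> : (p.-1 - (p - 3).+1 = 1)%N by lia.
have k0 := natr_lt_prime_neq0 kp.
by rewrite (_ : k%:R ^+ 1 / _ = k%:R ^- 1); [exact: cong_refl | field].
Qed.

Lemma rising_cong k : (k < p)%N ->
  cong p 2 (rising (- p%:R) k) (1 - p%:R * harmonic 1 k).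
Proof.
elim: k => [|k IHk] kp.
  by rewrite rising0 /harmonic big_geq // mulr0 subr0; apply: cong_refl.
have k1p : (0 < k.+1 < p)%N by lia.
have ki := invn_integral k1p.
have Hi : harmonic 1 k \in p_integral p by rewrite harmonic_integral // ltnW.
rewrite risingS harmonicS.
apply: (@cong_trans _ _ ((1 - p%:R * harmonic 1 k) * (1 + - p%:R / k.+1%:R))).
  rewrite mulrC [X in cong _ _ _ X]mulrC; apply: congMl;
    last exact: IHk (ltnW kp).
  by rewrite mulNr rpredB ?rpred1 // rpredM ?rpred_nat.
exists (harmonic 1 k * k.+1%:R^-1); first exact: rpredM.
by field; natr_neq0.
Qed.

Lemma inv_rising_sqr_cong k : (k < p)%N ->
  cong p 2 (rising (- p%:R) k ^- 2) (1 + 2 * p%:R * harmonic 1 k).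
Proof.
move=> kp; have Hi := @harmonic_integral 1 k kp.
have Rc := rising_cong kp; set R := rising _ k in Rc *.
have R1 : cong p 1 R 1.
  apply: cong_trans (congW _ Rc) _ => //; exists (- harmonic 1 k); last by ring.
  by rewrite rpredN.
have [R0 Ri] := cong1_unit p_prime R1.
have Rinv : cong p 2 R^-1 (1 + p%:R * harmonic 1 k).
  rewrite -[X in cong _ _ _ X](mulKf R0) -[X in cong _ _ X _]mulr1.
  apply: congMl => //; apply: cong_sym.
  apply: (@cong_trans _ _
    ((1 - p%:R * harmonic 1 k) * (1 + p%:R * harmonic 1 k))).
    rewrite mulrC [X in cong _ _ _ X]mulrC; apply: congMl => //.
    by rewrite rpredD ?rpred1 ?rpredM ?rpred_nat.
  exists (- harmonic 1 k ^+ 2); last by ring.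
  by rewrite rpredN rpredX.
rewrite -exprVn.
apply: (@cong_trans _ _
  ((1 + p%:R * harmonic 1 k) * (1 + p%:R * harmonic 1 k))).
  by apply: congM => //; rewrite rpredD ?rpred1 ?rpredM ?rpred_nat.
by exists (harmonic 1 k ^+ 2); [rewrite rpredX | ring].
Qed.

(** [alt_bin_sum 2 p.-1] is H2 - p D by [rising_cong] and -H2/2 by [alt_bin_sum2], since H1^2
    vanishes modulo p^2. *)
Lemma sum_rising_cong :
  cong p 2 (3 * harmonic 2 p.-1) (2 * p%:R * nested_sum).
Proof.
have H1 := harmonic_cong0 (e := 1).
have inv2 k : (1 <= k < p)%N -> k%:R ^- 2 \in p_integral p.
  by move=> kp; rewrite -exprVn rpredX // invn_integral.
have sq : cong p 2 (harmonic 1 p.-1 ^+ 2) 0.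
  have [|z zi] := H1; first by lia.
  rewrite subr0 => ->; exists (z ^+ 2); first by rewrite rpredX.
  by rewrite subr0; ring.
have E : alt_bin_sum 2 p.-1 =
    \sum_(1 <= k < p) rising (- p%:R) k * k%:R ^- 2.
  rewrite /alt_bin_sum prednK ?prime_gt0 //; apply: eq_big_nat => k kp.
  by rewrite rising_binB ?prime_gt0.
have c : cong p 2 (alt_bin_sum 2 p.-1) (harmonic 2 p.-1 - p%:R * nested_sum).
  rewrite E /harmonic prednK ?prime_gt0 // mulr_sumr -sumrB.
  apply: cong_sum_nat => k kp.
  have -> : k%:R ^- 2 - p%:R * (harmonic 1 k * k%:R ^- 2)
    = k%:R ^- 2 * (1 - p%:R * harmonic 1 k) by ring.
  rewrite mulrC; apply: congMl; first exact: inv2.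
  by apply: rising_cong; lia.
have := congMl (rpred_nat _ 2) c; rewrite alt_bin_sum2 => /congN c2.
have := congB (congB c2 sq) (cong_refl p 2 (- (2 * harmonic 2 p.-1))).
rewrite subr0 => c3.
have -> : 3 * harmonic 2 p.-1 = - - (harmonic 1 p.-1 ^+ 2 + harmonic 2 p.-1)
  - harmonic 1 p.-1 ^+ 2 - - (2 * harmonic 2 p.-1) by ring.
suff -> : 2 * p%:R * nested_sum
  = - (2 * (harmonic 2 p.-1 - p%:R * nested_sum))
    - - (2 * harmonic 2 p.-1) by [].
by ring.
Qed.

(** The 8 arises from 3 (H2 + 2 p D) = 2 p D + 6 p D modulo p^2. *)
Lemma sum_inv_rising_cong :
  cong p 2 (3 * \sum_(1 <= k < p) (k%:R * rising (- p%:R) k) ^- 2)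
           (8 * p%:R * nested_sum).
Proof.
have inv2 k : (1 <= k < p)%N -> k%:R ^- 2 \in p_integral p.
  by move=> kp; rewrite -exprVn rpredX // invn_integral.
apply: (@cong_trans _ _ (3 * (harmonic 2 p.-1 + 2 * p%:R * nested_sum))).
  apply: congMl; first exact: rpred_nat.
  rewrite /harmonic prednK ?prime_gt0 // mulr_sumr -big_split /=.
  apply: cong_sum_nat => k kp.
  have -> : k%:R ^- 2 + 2 * p%:R * (harmonic 1 k * k%:R ^- 2)
    = k%:R ^- 2 * (1 + 2 * p%:R * harmonic 1 k) by ring.
  rewrite exprMn invfM; apply: congMl; first exact: inv2.
  by apply: inv_rising_sqr_cong; lia.
have -> : 8 * p%:R * nested_sum
  = 2 * p%:R * nested_sum + 6 * p%:R * nested_sum by ring.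
rewrite mulrDr; apply: congD; first exact: sum_rising_cong.
have -> : 3 * (2 * p%:R * nested_sum) = 6 * p%:R * nested_sum by ring.
exact: cong_refl.
Qed.

(** The factor of the product at i = p is 2 and cancels the half. *)
Lemma half_central_cong : cong p 1 (half_central p) 1.
Proof.
have p0 := p_neq0 p_prime.
have -> : half_central p = \prod_(1 <= i < p) (1 + p%:R / i%:R).
  rewrite /half_central /rising big_nat_recr ?prime_gt0 //=.
  by rewrite divff // mulfK.
rewrite big_nat; apply: cong_prod1 => i ip.
by exists i%:R^-1; [exact: invn_integral | ring].
Qed.

Lemma central_sum_large_prime :
  cong p 3 (\sum_(1 <= k < p) 'C(2 * k, k)%:R / k%:R)
           (8%:R / 9%:R * p%:R ^+ 2 * bernoulli (p - 3)).
Proof.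
have Bi : bernoulli (p - 3) \in p_integral p by apply: bernoulli_integral; lia.
have co3 : (3%:R)^-1 \in p_integral p by apply: invn_integral => //; lia.
have -> : \sum_(1 <= k < p) 'C(2 * k, k)%:R / k%:R = p%:R / 3 *
    (half_central p * \sum_(1 <= k < p) (k%:R * rising (- p%:R) k) ^- 2).
  have := central_sumE p_prime 0; rewrite expr0 mul1r expn1 => ->.
  rewrite /staver_sum expn1 big_nat_recr ?prime_gt0 //=.
  rewrite /staver_term expn1 rising_binB ?prime_gt0 // bin_small; last by lia.
  rewrite !mulr0 invr0 mulr0 expr0n addr0; congr (_ * (_ * _)).
  by apply: eq_bigr => k _; rewrite expr0 mul1r exprVn.
set S := \sum_(1 <= k < p) _.
have S3 : cong p 2 (3 * S) (8 * p%:R * bernoulli (p - 3)).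
  apply: cong_trans sum_inv_rising_cong _; rewrite -!mulrA.
  apply: congMl; first exact: rpred_nat.
  by apply: cong_scale1; apply: nested_sum_cong.
have hi := cong_integral half_central_cong (rpred1 _).
have hS : cong p 2 (half_central p * (3 * S)) (8 * p%:R * bernoulli (p - 3)).
  apply: cong_trans (congMl hi S3) _.
  (* The explicit p means that [half_central p] is needed only modulo p. *)
  have -> : half_central p * (8 * p%:R * bernoulli (p - 3))
    = p%:R * ((8 * bernoulli (p - 3)) * half_central p) by ring.
  have -> : 8 * p%:R * bernoulli (p - 3)
    = p%:R * ((8 * bernoulli (p - 3)) * 1) by ring.
  apply: cong_scale1; apply: congMl; last exact: half_central_cong.
  by rewrite rpredM ?rpred_nat.
have -> : p%:R / 3 * (half_central p * S)
  = 3^-1 * 3^-1 * (p%:R * (half_central p * (3 * S))) by field.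
have -> : 8%:R / 9%:R * p%:R ^+ 2 * bernoulli (p - 3)
  = 3^-1 * 3^-1 * (p%:R * (8 * p%:R * bernoulli (p - 3))) by field.
by apply: congMl; [exact: rpredM | exact: cong_scale1].
Qed.

End LargePrime.

Theorem theorem1p3 (p a : nat) (p_prime : prime p) (a_gt0 : (0 < a)%N) :
  p_congruent p (p%:R ^+ 3)
    (p%:R ^+ (a - 1) * \sum_(1 <= k < (p ^ a)%N) 'C(2 * k, k)%:R / k%:R)
    (if p == 2%N then 2%:R
     else if p == 3%N then 5%:R
     else 8%:R / 9%:R * p%:R ^+ 2 * bernoulli (p - 3)).
Proof.
case: a a_gt0 => // a _; rewrite subn1 /=.
set rhs := if _ then _ else _.
have rhs_i : rhs \in p_integral p.
  rewrite /rhs; case: eqP => [_|p2]; first exact: rpred_nat.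
  case: eqP => [_|p3]; first exact: rpred_nat.
  have p_gt4 : (4 < p)%N by apply: prime_gt4.
  have i3 : (3%:R)^-1 \in p_integral p by apply: invn_integral => //; lia.
  have i89 : 8%:R / 9%:R \in p_integral p.
    have -> : 8%:R / 9%:R = 8 * (3^-1 * 3^-1) :> rat by field.
    by rewrite !rpredM ?rpred_nat.
  apply: rpredM; last by apply: bernoulli_integral; lia.
  by apply: rpredM; [exact: i89 | rewrite rpredX ?rpred_nat].
have c : cong p 3
    (p%:R ^+ a * \sum_(1 <= k < (p ^ a.+1)%N) 'C(2 * k, k)%:R / k%:R) rhs.
  apply: cong_trans (central_sum_reduction p_prime a) _.
  rewrite /rhs; case: eqP => [->|p2].
    by rewrite big_nat1 divr1; exact: cong_refl.
  case: eqP => [->|p3].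
    rewrite big_ltn // big_nat1.
    have -> : 'C(2 * 1, 1)%:R / 1%:R + 'C(2 * 2, 2)%:R / 2%:R = 5 :> rat.
      by apply/eqP.
    exact: cong_refl.
  by apply: central_sum_large_prime => //; apply: prime_gt4.
by split=> //; apply: cong_integral c rhs_i.
Qed.
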